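(* Let $n$ be a positive integer with $n\equiv 0\pmod 2$, and let $C$ be a Type IV code of length $n$. Then for every integer $k$ with $0<k\le\frac n2$, the number $L_k^{\mathrm{IV}}(n)$ of Type IV codes of length $n$ that are $k$-neighbors of $C$ is $$L_k^{\mathrm{IV}}(n)=\frac{\prod_{i=0}^{k-1}\left(2^{\,2n-1-2i}-2^{\,n-1}\right)}{\prod_{j=0}^{k-1}\left(2^{n}-2^{\,n-2-2j}\right)}.$$
   Context: Equip $\mathbb{F}_4^n$ with the Hermitian inner product $u\cdot v=\sum_{i=1}^n u_iv_i^2$. A code of length $n$ over $\mathbb{F}_4$ is an $\mathbb{F}_4$-linear subspace $C\subseteq\mathbb{F}_4^n$; its dual is $C^\perp=\{v\in\mathbb{F}_4^n : u\cdot v=0\text{ for all }u\in C\}$, and $C$ is self-dual if $C=C^\perp$ (so $\dim C=n/2$). The weight of a vector is its number of nonzero coordinates. A Type IV code is a self-dual code over $\mathbb{F}_4$ in which every codeword has even weight. For $0\le k\le n/2$, two self-dual codes $C,D$ of length $n$ are $k$-neighbors if $\dim(C\cap D)=\frac n2-k$. *)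

(* Defs.v *)
From HB Require Import structures.
From mathcomp Require Import all_boot all_order all_algebra all_field.

Set Implicit Arguments.
Unset Strict Implicit.
Unset Printing Implicit Defensive.

Import GRing.Theory.
Local Open Scope ring_scope.

(* The subspaces of a finite-dimensional space over a finite field form a
   finite type, so sets of codes can be counted with #|_|. *)
Section FiniteSubspaces.
Import VectorInternalTheory.
Variables (F : finFieldType) (vT : vectType F).

HB.instance Definition _ := [Countable of {vspace vT} by <:].
HB.instance Definition _ := [Finite of {vspace vT} by <:].
End FiniteSubspaces.

(* Below, F is meant to have four elements, so that x |-> x ^+ 2 is the
   conjugation of F over its prime field. Codes of length n over F are the
   elements of {vspace 'rV[F]_n}. *)

Definition herm (F : finFieldType) (n : nat) (u v : 'rV[F]_n) : F :=
  \sum_(i < n) u 0 i * v 0 i ^+ 2.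

(* The dual is given as a set of vectors; it is a subspace only when squaring
   is additive on F. *)
Definition dual (F : finFieldType) (n : nat) (C : {vspace 'rV[F]_n}) :
    {set 'rV[F]_n} :=
  [set v | [forall u in C, herm u v == 0]].

Definition self_dual (F : finFieldType) (n : nat) (C : {vspace 'rV[F]_n}) :
    bool :=
  [set v in C] == dual C.

Definition weight (F : finFieldType) (n : nat) (v : 'rV[F]_n) : nat :=
  #|[set i : 'I_n | v 0 i != 0]|.

Definition type_IV (F : finFieldType) (n : nat) (C : {vspace 'rV[F]_n}) :
    bool :=
  self_dual C && [forall v in C, ~~ odd (weight v)].

(* The guard k <= n./2 keeps the truncated subtraction n./2 - k exact. *)
Definition neighbors (F : finFieldType) (n k : nat)
    (C D : {vspace 'rV[F]_n}) : bool :=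
  [&& k <= n./2, self_dual C, self_dual D
    & \dim (C :&: D)%VS == n./2 - k]%N.

Definition num_type_IV_neighbors (F : finFieldType) (n k : nat)
    (C : {vspace 'rV[F]_n}) : nat :=
  #|[set D : {vspace 'rV[F]_n} | type_IV D && neighbors k C D]|.

(* Main.v *)
Require Import Defs.
From mathcomp Require Import all_boot all_order all_algebra all_field.
From mathcomp Require Import zify ring.

(** A self-dual code has only words of even weight, because the Hermitian
    square of a word is the parity of its weight. So the codes to be counted
    are all the Lagrangian subspaces D (those equal to their orthogonal) of the
    Hermitian space of dimension n = 2m over the field with four elements for
    which C :&: D has codimension k in C. These D form the k-th layer around
    C; let N_k be their number. Then N_0 = 1, and it remains to find
    N_(k+1) / N_k.

    Call two Lagrangians adjacent when they meet in a hyperplane of each. If D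
    is Lagrangian and v is an isotropic vector outside D, there is exactly one
    Lagrangian adjacent to D that contains v, namely the hyperplane of D
    orthogonal to v, plus the line of v ([switch], [switch_unique]). Hence the
    differences E minus D, for E adjacent to D, partition the isotropic vectors
    outside D. Let P be the number of adjacent pairs (D, E) with D in layer k
    and E in layer k+1. It is computed in two ways.

    - Fix D. The vectors that move D from layer k to layer k+1 are the
      isotropic vectors outside C + D ([sum_switch_up]). Outside a subspace W
      that contains a Lagrangian, exactly half of the vectors are isotropic
      ([card_isotropic_out]), so
      P (4^m - 4^(m-1)) = N_k (4^(2m) - 4^(m+k)) / 2.
    - Fix E. Every vector of C outside E moves E back to layer k
      ([sum_switch_down]), so
      P (4^(m-k) - 4^(m-k-1)) = N_(k+1) (4^m - 4^(m-k-1)).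

    Eliminating P gives [card_layerS], and the quotient N_(k+1) / N_k found
    there is the quotient of the factors of index k in the two products. *)

Set Implicit Arguments.
Unset Strict Implicit.
Unset Printing Implicit Defensive.

Import GRing.Theory.
Local Open Scope ring_scope.

(** The double counts below all have this form: each vector of [B] singles
    out one Lagrangian among those indexed by [P]. *)
Lemma sum_card_unique (I T : finType) (P : pred I) (A : I -> {set T})
    (B : {set T}) :
  (forall i, P i -> A i \subset B) ->
  (forall v, v \in B -> exists i, P i /\ v \in A i) ->
  (forall i j v, P i -> P j -> v \in A i -> v \in A j -> i = j) ->
  (\sum_(i | P i) #|A i| = #|B|)%N.
Proof.
move=> AB covB uniqA.
transitivity (\sum_(i | P i) \sum_(v in B | v \in A i) 1)%N.
  apply: eq_bigr => i Pi; rewrite sum1dep_card; apply: eq_card => v.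
  rewrite !inE; case: (boolP (v \in A i)) => [/(subsetP (AB i Pi))->|] //.
  by rewrite andbF.
rewrite (exchange_big_dep (fun v => v \in B)) /=; last by move=> i v _ /andP[].
rewrite -sum1_card; apply: eq_bigr => v Bv; have [i [Pi Aiv]] := covB v Bv.
rewrite (bigD1 i) /= ?Pi ?Bv //= big1 ?addn0 // => j.
by case/andP=> /andP[Pj Ajv]; rewrite (uniqA j i v) ?eqxx.
Qed.

(** * The field with four elements and the Hermitian form *)

Section Hermitian.

Variables (F : finFieldType) (hF : #|F| = 4%N) (n : nat).
Local Notation V := 'rV[F]_n.
Implicit Types (u v w : V) (U W C D E : {vspace V}).

Lemma pchar2 : 2%N \in [pchar F].
Proof. by apply: (@card_finPcharP F 2 2). Qed.

Lemma addff (T : lmodType F) (x : T) : x + x = 0.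
Proof.
have := pcharf0 pchar2 => h.
by rewrite -[x]scale1r -scalerDl -[1 + 1]/(2%:R) h scale0r.
Qed.

Lemma sqrfD (a b : F) : (a + b) ^+ 2 = a ^+ 2 + b ^+ 2.
Proof. by rewrite -[LHS]/(pFrobenius_aut pchar2 _) rmorphD. Qed.

Lemma sqrrK4 (a : F) : (a ^+ 2) ^+ 2 = a.
Proof. by rewrite -exprM -[RHS]expf_card hF. Qed.

(** The trace to the prime field is onto: either element outside the prime
    field is a root of X^2 + X + 1. *)
Lemma exists_trace1 : exists a : F, a + a ^+ 2 = 1.
Proof.
have [a /norP[a0 a1]] : exists a : F, ~~ ((a == 0) || (a == 1)).
  apply/existsP; rewrite -negb_forall; apply/negP => /forallP h.
  have : (#|[set: F]| <= #|[set 0%R; 1%R : F]|)%N.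
    by apply: subset_leq_card; apply/subsetP => x _; rewrite !inE.
  by rewrite cardsT hF cards2; case: (_ == _).
exists a.
(* the elements of the field are the roots of X (X - 1) (X^2 + X + 1) *)
have e : a * (a - 1) * (a + a ^+ 2 + 1) = 0.
  have -> : a * (a - 1) * (a + a ^+ 2 + 1) = a ^+ 4 - a by ring.
  by rewrite -hF expf_card subrr.
move/eqP: e; rewrite !mulf_eq0 (negPf a0) subr_eq0 (negPf a1) /= addr_eq0.
move/eqP->; apply/esym/eqP; rewrite -addr_eq0.
by rewrite (addff (1 : F^o)).
Qed.

Lemma hermDl u v w : herm (u + v) w = herm u w + herm v w.
Proof. by rewrite -big_split; apply: eq_bigr => i _; rewrite mxE mulrDl. Qed.

Lemma hermZl a u v : herm (a *: u) v = a * herm u v.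
Proof. by rewrite mulr_sumr; apply: eq_bigr => i _; rewrite mxE mulrA. Qed.

Lemma sqr_sum (I : Type) (r : seq I) (P : pred I) (f : I -> F) :
  (\sum_(i <- r | P i) f i) ^+ 2 = \sum_(i <- r | P i) f i ^+ 2.
Proof.
rewrite -[LHS]/(pFrobenius_aut pchar2 _) rmorph_sum.
by apply: eq_bigr.
Qed.

Lemma hermC u v : herm v u = herm u v ^+ 2.
Proof.
rewrite sqr_sum; apply: eq_bigr => i _.
by rewrite exprMn sqrrK4 mulrC.
Qed.

Lemma hermDr u v w : herm u (v + w) = herm u v + herm u w.
Proof. by rewrite hermC hermDl sqrfD -!hermC. Qed.

Lemma herm_eq0C u v : (herm u v == 0) = (herm v u == 0).
Proof. by rewrite [herm v u]hermC sqrf_eq0. Qed.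

Lemma herm0l v : herm 0 v = 0.
Proof. by rewrite -(scale0r 0) hermZl mul0r. Qed.

Lemma herm_suml (I : Type) (r : seq I) (P : pred I) (f : I -> V) v :
  herm (\sum_(i <- r | P i) f i) v = \sum_(i <- r | P i) herm (f i) v.
Proof.
apply: (big_morph (fun u => herm u v)) => [u w|]; first exact: hermDl.
exact: herm0l.
Qed.

(** A nonzero coordinate x contributes x^3 = 1. *)
Lemma herm_self u : herm u u = (weight u)%:R.
Proof.
rewrite /weight -sum1_card natr_sum big_mkcond /=; apply: eq_bigr => i _.
rewrite inE; have [->|nz] := eqVneq (u 0 i) 0; first by rewrite mul0r.
apply: (mulfI nz); by rewrite mulr1 -exprS -exprS -[RHS]expf_card hF.
Qed.

Lemma herm_self_odd v : herm v v = (odd (weight v))%:R.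
Proof.
by rewrite herm_self -{1}[weight v]odd_double_half natrD -addnn natrD
  (addff (_ : F^o)) addr0.
Qed.

(** * Orthogonal subspaces *)

Definition conjmx U : 'M[F]_(n, \dim U) :=
  \matrix_(i, j) (vbasis U)`_j 0 i ^+ 2.

(** The dual code as a subspace: the words orthogonal to a basis. *)
Definition orth U : {vspace V} :=
  lker (linfun (mulmxr (conjmx U) : V -> 'rV_(\dim U))).

Lemma conjmxE U u j : (u *m conjmx U) 0 j = herm u (vbasis U)`_j.
Proof. by rewrite mxE; apply: eq_bigr => i _; rewrite mxE. Qed.

Lemma orthP U v : reflect (forall u, u \in U -> herm u v = 0) (v \in orth U).
Proof.
rewrite memv_ker lfunE /=; apply: (iffP eqP) => [h u /coord_vbasis-> | h].
  rewrite herm_suml big1 // => i _; rewrite hermZl.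
  by rewrite hermC -conjmxE h mxE expr0n mulr0.
apply/rowP => j; rewrite conjmxE mxE hermC h ?expr0n //.
by rewrite vbasis_mem // mem_nth ?size_tuple.
Qed.

(** Conjugation is a field automorphism, so it preserves the rank of the
    matrix whose rows are a basis. *)
Lemma rank_conjmx U : \rank (conjmx U) = \dim U.
Proof.
pose B : 'M[F]_(\dim U, n) := \matrix_(j, i) (vbasis U)`_j 0 i.
have -> : conjmx U = (map_mx (pFrobenius_aut pchar2) B)^T.
  by apply/matrixP => i j; rewrite !mxE.
rewrite mxrank_tr mxrank_map; apply/eqP; apply/row_freeP.
suff: row_free B by move/row_freeP.
rewrite -kermx_eq0; apply/eqP/row_matrixP => i; rewrite row0.
set r := row i _; have : r *m B = 0 by rewrite -row_mul mulmx_ker row0.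
move=> rB; have/freeP fU := basis_free (vbasisP U).
apply/rowP => j; rewrite [RHS]mxE; apply: fU.
rewrite -[RHS]rB; apply/rowP => k; rewrite summxE mxE.
by apply: eq_bigr => l _; rewrite !mxE.
Qed.

Lemma dim_orth U : (\dim (orth U) + \dim U = n)%N.
Proof.
have := limg_ker_dim (linfun (mulmxr (conjmx U) : V -> 'rV_(\dim U))) fullv.
rewrite capfv -/(orth U) dimvf /dim /= mul1n => e.
rewrite -[RHS]e; congr (_ + _)%N.
suff -> : limg (linfun (mulmxr (conjmx U) : V -> 'rV_(\dim U))) = fullv.
  by rewrite dimvf /dim /= mul1n.
apply/eqP; rewrite eqEsubv subvf; apply/subvP => y _.
have /row_fullP[N NM] : row_full (conjmx U) by rewrite /row_full rank_conjmx.
have -> : y = linfun (mulmxr (conjmx U) : V -> 'rV_(\dim U)) (y *m N).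
  by rewrite lfunE /= -mulmxA NM mulmx1.
by rewrite memv_img ?memvf.
Qed.

Lemma orth_memC U W : (U <= orth W)%VS = (W <= orth U)%VS.
Proof.
suff h U1 U2 : (U1 <= orth U2)%VS -> (U2 <= orth U1)%VS by apply/idP/idP; apply: h.
move=> /subvP sub; apply/subvP => w wU2; apply/orthP => u /sub/orthP/(_ w wU2)/eqP.
by rewrite herm_eq0C => /eqP.
Qed.

Lemma orthK U : orth (orth U) = U.
Proof.
apply/esym/eqP; rewrite eqEdim orth_memC subvv /=.
have := dim_orth U; have := dim_orth (orth U); lia.
Qed.

Lemma orthS U W : (U <= W)%VS -> (orth W <= orth U)%VS.
Proof. by move=> UW; rewrite orth_memC orthK. Qed.

(** The inclusion of C + D is clear, and the dimensions agree. *)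
Lemma orth_cap_lagr C D : orth C = C -> orth D = D ->
  orth (C :&: D)%VS = (C + D)%VS.
Proof.
move=> oC oD; apply/esym/eqP; rewrite eqEdim; apply/andP; split.
  rewrite subv_add -{1}oC orthS ?capvSl //=.
  by rewrite -{1}oD orthS ?capvSr.
have := dim_orth (C :&: D); have := dimv_sum_cap C D.
have := dim_orth C; have := dim_orth D; rewrite oC oD; lia.
Qed.

Lemma mem_orth1 u v : (u \in orth <[v]>) = (herm u v == 0).
Proof.
apply/orthP/eqP => [/(_ v (memv_line v))|uv w /vlineP[a ->]].
  by rewrite hermC => /eqP; rewrite sqrf_eq0 => /eqP ->.
by rewrite hermZl hermC uv expr0n mulr0.
Qed.

Lemma dim_cap_orth1 W v : v \notin orth W ->
  (\dim (W :&: orth <[v]>)).+1 = \dim W.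
Proof.
move=> nv.
have v0 : v != 0 by apply: contraNneq nv => ->; apply: mem0v.
have h : ~~ (W <= orth <[v]>)%VS by rewrite orth_memC.
have := dim_orth <[v]>; rewrite dim_vline v0 => e1.
have := dimv_sum_cap W (orth <[v]>) => e2.
have h3 : (\dim (orth <[v]>) < \dim (W + orth <[v]>))%N.
  rewrite ltn_neqAle dimvS ?addvSr // andbT.
  rewrite (dimv_leqif_eq (addvSr W (orth <[v]>))).
  by apply: contra h => /eqP ->; rewrite addvSl.
have h4 : (\dim (W + orth <[v]>) <= n)%N.
  by have := dimvS (subvf (W + orth <[v]>)); rewrite dimvf /dim /= mul1n.
lia.
Qed.

(** * Adjacent Lagrangians *)

Definition adjacent D E := (\dim (D :&: E)).+1 == \dim D.

Definition switch D v : {vspace V} := (D :&: orth <[v]> + <[v]>)%VS.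

Section Switch.
Variables (D : {vspace V}) (v : V).
Hypotheses (oD : orth D = D) (vv : herm v v = 0) (vD : v \notin D).

Lemma mem_switch : v \in switch D v.
Proof. by rewrite memvE addvSr. Qed.

Lemma dim_switch : \dim (switch D v) = \dim D.
Proof.
rewrite -(@dim_cap_orth1 D v) ?oD // /switch.
have := dimv_sum_cap (D :&: orth <[v]>) <[v]>.
have -> : (D :&: orth <[v]> :&: <[v]> = 0)%VS.
  apply/eqP; rewrite -subv0; apply/subvP => w.
  rewrite !memv_cap => /andP[/andP[wD _] /vlineP[a wE]].
  move: wD; rewrite wE; have [->|a0] := eqVneq a 0; first by rewrite scale0r !mem0v.
  by move=> /(memvZ a^-1); rewrite scalerA mulVf // scale1r (negPf vD).
rewrite dimv0 dim_vline.
have -> : v != 0 by apply: contraNneq vD => ->; apply: mem0v.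
lia.
Qed.

(** [switch D v] is isotropic because [v] is, and it is maximal because it
    has the dimension of [D]. *)
Lemma switch_lagr : orth (switch D v) = switch D v.
Proof.
apply/esym/eqP; rewrite eqEdim; apply/andP; split; last first.
  have := dim_orth (switch D v); have := dim_orth D.
  by rewrite dim_switch oD; lia.
rewrite subv_add; apply/andP; split.
  rewrite orth_memC subv_add; apply/andP; split.
    by rewrite (subv_trans (capvSl _ _)) // -{1}oD orthS ?capvSl.
  by rewrite orth_memC capvSr.
rewrite orth_memC subv_add capvSr /= -memvE mem_orth1; exact/eqP.
Qed.

Lemma cap_switch : (D :&: switch D v = D :&: orth <[v]>)%VS.
Proof.
apply/eqP; rewrite eqEsubv; apply/andP; split; last first.
  by rewrite subv_cap capvSl addvSl.
by rewrite subv_cap capvSl -switch_lagr (subv_trans (capvSr _ _)) // orthS // addvSr.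
Qed.

Lemma adjacent_switch : adjacent D (switch D v).
Proof. by rewrite /adjacent cap_switch dim_cap_orth1 ?oD. Qed.

(** An adjacent [E] that contains [v] is orthogonal to [v], so it meets [D]
    inside the hyperplane orthogonal to [v], and hence in all of it. *)
Lemma switch_unique E : orth E = E -> adjacent D E -> v \in E -> E = switch D v.
Proof.
move=> oE adj vE.
have sub : (D :&: E <= D :&: orth <[v]>)%VS.
  by rewrite subv_cap capvSl (subv_trans (capvSr _ _)) // -{1}oE orthS // -memvE.
have e : (D :&: E = D :&: orth <[v]>)%VS.
  apply/eqP; rewrite eqEdim sub.
  have := @dim_cap_orth1 D v; rewrite oD => /(_ vD).
  by move/eqP: adj; lia.
apply/esym/eqP; rewrite eqEdim; apply/andP; split.
  by rewrite subv_add -e capvSr -memvE.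
by rewrite dim_switch; have := dim_orth E; have := dim_orth D; rewrite oD oE; lia.
Qed.

End Switch.

Lemma lagr_isotropic C u v : orth C = C -> u \in C -> v \in C -> herm u v = 0.
Proof. by move=> oC uC; rewrite -oC => /orthP->. Qed.

Lemma lagr_dim C D : orth C = C -> orth D = D -> \dim C = \dim D.
Proof.
by move=> oC oD; have := dim_orth C; have := dim_orth D; rewrite oC oD; lia.
Qed.

Lemma adjacentC D E : orth D = D -> orth E = E -> adjacent D E -> adjacent E D.
Proof. by move=> oD oE; rewrite /adjacent capvC (lagr_dim oD oE). Qed.

(** The hyperplane [D :&: E] of [D] cuts any subspace of [D] in codimension
    at most one, so adjacent Lagrangians lie in the same or in consecutive
    layers. *)
Lemma adjacent_dim_cap C D E : adjacent D E ->
  (\dim (C :&: D) <= (\dim (C :&: D :&: E)).+1)%N.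
Proof.
move=> /eqP adj.
have := dimv_sum_cap (C :&: D) (D :&: E).
have -> : (C :&: D :&: (D :&: E) = C :&: D :&: E)%VS.
  by rewrite capvA -[(C :&: D :&: D)%VS]capvA capvv.
have : (\dim (C :&: D + (D :&: E)) <= \dim D)%N.
  by apply: dimvS; rewrite subv_add capvSr capvSl.
lia.
Qed.

(** * Layers around a Lagrangian *)

Section Layers.
Variable C : {vspace V}.
Hypothesis oC : orth C = C.

Definition layer k : {set {vspace V}} :=
  [set D | (orth D == D) && (\dim (C :&: D) + k == \dim C)%N].

Lemma layerP k D :
  reflect (orth D = D /\ (\dim (C :&: D) + k = \dim C)%N) (D \in layer k).
Proof. by rewrite inE; apply: (iffP andP) => -[/eqP ? /eqP ?]. Qed.

Lemma card_layer0 : #|layer 0| = 1%N.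
Proof.
apply/eqP/cards1P; exists C; apply/setP => D; rewrite inE.
apply/layerP/eqP => [[oD]|->]; last by rewrite capvv addn0.
rewrite addn0 => /eqP; rewrite (dimv_leqif_eq (capvSl C D)) => /eqP e.
apply/esym/eqP; rewrite eqEdim (lagr_dim oC oD) leqnn andbT.
by rewrite -e capvSr.
Qed.

(** The vectors that lead away from [C]. By [orth_cap_lagr], v lies in [C + D]
    exactly when it is orthogonal to [C :&: D]. If so, [switch D v] still
    contains [C :&: D] and is no farther from [C]; if not, it meets [C] only
    in the hyperplane of [C :&: D] orthogonal to v. *)
Lemma sum_switch_up k D : D \in layer k ->
  (\sum_(E in layer k.+1 | adjacent D E) #|[set v in E | v \notin D]|
   = #|[set v : V | (herm v v == 0%R) && (v \notin C + D)%VS]|)%N.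
Proof.
move=> /layerP[oD dD]; apply: sum_card_unique.
- move=> E /andP[/layerP[oE dE] adj]; apply/subsetP => v.
  rewrite !inE => /andP[vE vD]; rewrite (lagr_isotropic oE) ?eqxx //=.
  rewrite -orth_cap_lagr //; apply/negP => vo.
  have vv := lagr_isotropic oE vE vE.
  have EE := switch_unique oD vD oE adj vE.
  have : (C :&: D <= C :&: E)%VS.
    rewrite subv_cap capvSl /= EE (subv_trans _ (addvSl _ _)) //.
    by rewrite subv_cap capvSr orth_memC -memvE.
  by move=> /dimvS; lia.
- move=> v; rewrite inE -orth_cap_lagr // => /andP[/eqP vv nv].
  have vD : v \notin D.
    apply: contra nv => vD; rewrite orth_cap_lagr //.
    by apply: subvP vD; apply: addvSr.
  exists (switch D v); split; last by rewrite inE vD mem_switch.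
  rewrite adjacent_switch // andbT; apply/layerP; split; first exact: switch_lagr.
  suff -> : (C :&: switch D v = C :&: D :&: orth <[v]>)%VS.
    by rewrite -dD -(dim_cap_orth1 nv); lia.
  apply/eqP; rewrite eqEsubv; apply/andP; split; last first.
    by rewrite -capvA capvS // addvSl.
  apply/subvP => x; rewrite -capvA memv_cap => /andP[xC].
  move=> /memv_addP[y yD [z /vlineP[a ->] xE]].
  rewrite memv_cap xC /=.
  have [a0|a0] := eqVneq a 0; first by rewrite xE a0 scale0r addr0.
  (* otherwise v would be a combination of x in C and y in D *)
  case/negP: nv; rewrite orth_cap_lagr //.
  have -> : v = a^-1 *: x + - (a^-1 *: y).
    by rewrite xE scalerDr scalerA mulVf // scale1r addrC addKr.
  rewrite memv_add ?memvN ?memvZ //.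
  by move: yD; rewrite memv_cap => /andP[].
- move=> E E' v /andP[/layerP[oE _] aE] /andP[/layerP[oE' _] aE'].
  rewrite !inE => /andP[vE vD] /andP[vE' _].
  by rewrite (switch_unique oD vD oE aE vE) (switch_unique oD vD oE' aE' vE').
Qed.

(** The vectors that lead towards [C]. As [C] is isotropic, [C :&: E] is
    orthogonal to each v in [C], so [switch E v] contains both [C :&: E]
    and v. *)
Lemma sum_switch_down k E : E \in layer k.+1 ->
  (\sum_(D in layer k | adjacent D E) #|[set v in (C :&: D)%VS | v \notin E]|
   = #|[set v in C | v \notin E]|)%N.
Proof.
move=> /layerP[oE dE]; apply: sum_card_unique.
- move=> D _; apply/subsetP => v; rewrite !inE memv_cap.
  by move=> /andP[/andP[-> _] ->].
- move=> v; rewrite inE => /andP[vC vE].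
  have vv := lagr_isotropic oC vC vC.
  have oD := switch_lagr oE vv vE.
  have aD := adjacentC oE oD (adjacent_switch oE vv vE).
  exists (switch E v); split; last by rewrite inE memv_cap vC mem_switch.
  rewrite aD andbT; apply/layerP; split=> //.
  have up : (\dim (C :&: switch E v) <= (\dim (C :&: E)).+1)%N.
    apply: leq_trans (adjacent_dim_cap C aD) _.
    by rewrite ltnS dimvS // capvS // capvSl.
  have sub : (C :&: E <= C :&: switch E v)%VS.
    rewrite subv_cap capvSl /= (subv_trans _ (addvSl _ _)) //.
    by rewrite subv_cap capvSr (subv_trans (capvSl _ _)) // orth_memC oC -memvE.
  have : (\dim (C :&: E) < \dim (C :&: switch E v))%N.
    rewrite ltn_neqAle dimvS // andbT (dimv_leqif_eq sub).
    apply: contra vE => /eqP e.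
    have : v \in (C :&: switch E v)%VS by rewrite memv_cap vC mem_switch.
    by rewrite -e memv_cap => /andP[].
  lia.
- move=> D D' v /andP[/layerP[oD _] aD] /andP[/layerP[oD' _] aD'].
  rewrite !inE !memv_cap => /andP[/andP[_ vD] vE] /andP[/andP[_ vD'] _].
  have aD1 := adjacentC oD oE aD; have aD1' := adjacentC oD' oE aD'.
  by rewrite (switch_unique oE vE oD aD1 vD) (switch_unique oE vE oD' aD1' vD').
Qed.

End Layers.

(** * Counting vectors *)

Lemma card_vs U : #|[set v in U]| = (4 ^ \dim U)%N.
Proof. by rewrite cardsE -hF -(card_vspace U). Qed.

Lemma card_vsD U W :
  (#|[set v in U | v \notin W]| + 4 ^ \dim (U :&: W) = 4 ^ \dim U)%N.
Proof.
rewrite -!card_vs -(cardsID [set v in W] [set v in U]) addnC.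
by congr (_ + _)%N; apply: eq_card => v; rewrite !inE ?memv_cap // andbC.
Qed.

(** Pair v with v + c, where c in [C] is chosen so that herm c v has trace 1;
    it exists because v is not orthogonal to [C]. Since c is isotropic, this
    changes the Hermitian square of v by the trace of herm c v, that is by 1.
    The choice depends only on herm c v for c in [C], thus only on the coset
    of v modulo the isotropic space [C], and in characteristic 2 this makes
    the pairing an involution. *)
Lemma card_isotropic_out C W : orth C = C -> (C <= W)%VS ->
  (#|[set v : V | (herm v v == 0%R) && (v \notin W)]|.*2 + 4 ^ \dim W = 4 ^ n)%N.
Proof.
move=> oC CW.
pose tr v c := herm c v + herm c v ^+ 2.
(* the default 0 is reached only when v is orthogonal to C *)
pose f v : V := v + odflt 0 [pick c in C | tr v c == 1].
have f_off v : f v - v \in C.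
  rewrite /f addrAC subrr add0r; case: pickP => [c /andP[]//|_] /=; exact: mem0v.
have fP v : v \notin W -> herm (f v) (f v) = herm v v + 1.
  move=> nv; have vC : v \notin orth C by rewrite oC; apply: contra nv; apply: subvP.
  rewrite /f; case: pickP => [c /andP[cC /eqP trc]|no] /=.
    rewrite hermDl !hermDr (lagr_isotropic oC cC cC) addr0 (hermC c v).
    by rewrite -trc /tr -addrA [herm c v + _]addrC.
  case/negP: vC; apply/orthP => c cC; apply/eqP; apply: contraT => nz.
  have [a ta] := exists_trace1.
  have := no ((a / herm c v) *: c); rewrite memvZ //= /tr hermZl divfK // ta.
  by rewrite eqxx.
have fK v : f (f v) = v.
  have e : [pick c in C | tr (f v) c == 1] = [pick c in C | tr v c == 1].
    apply: eq_pick => c /=; case: (boolP (c \in C)) => //= cC.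
    rewrite /tr -[f v](subrK v) hermDr.
    by rewrite (lagr_isotropic oC cC (f_off v)) add0r.
  by rewrite {1}/f e /f -addrA addff addr0.
have fW v : (f v \in W) = (v \in W).
  have := subvP CW _ (f_off v) => h; apply/idP/idP => vW.
    by rewrite -[v](subKr (f v)) memvB.
  by rewrite -[f v](subrK v) memvD.
have fq v : v \notin W -> (herm (f v) (f v) == 0) = (herm v v != 0).
  move=> nv; rewrite fP // !herm_self_odd; case: odd => /=.
    by rewrite (addff (1 : F^o)) eqxx oner_eq0.
  by rewrite add0r eqxx oner_eq0.
set A := [set v | _].
have cA : #|[set v : V | (herm v v != 0) && (v \notin W)]| = #|A|.
  rewrite -(card_imset A (can_inj fK)); apply: eq_card => v; apply/idP/imsetP.
    rewrite inE => /andP[vv nv]; exists (f v); last by rewrite fK.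
    by rewrite inE fW nv andbT fq.
  move=> [w]; rewrite [w \in A]inE => /andP[ww nw] ->.
  by rewrite inE fW nw andbT fq // ww.
have := card_vsD fullv W; rewrite capfv dimvf /dim /= mul1n => <-.
rewrite -addnn -{2}cA; congr (_ + _)%N.
rewrite -[RHS](cardsID [set v : V | herm v v == 0]); congr (_ + _)%N.
  by apply: eq_card => v; rewrite !inE memvf andbC.
by apply: eq_card => v; rewrite !inE memvf.
Qed.

(** * The recursion between layers *)

Section Recursion.
Variable C : {vspace V}.
Hypothesis oC : orth C = C.

(** Both counts of the adjacent pairs between two consecutive layers, with
    the number of pairs eliminated. *)
Lemma card_layerS k : (k < \dim C)%N ->
  (#|layer C k.+1| * (4 ^ \dim C - 4 ^ (\dim C - k.+1)) =
   #|layer C k| * (4 ^ \dim C %/ 2 * (4 ^ (\dim C - k) - 1)))%N.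
Proof.
move=> km; set m := \dim C; have n2 : n = (m + m)%N.
  by have := dim_orth C; rewrite oC.
set x := (4 ^ (m - k.+1))%N; set z := (4 ^ k)%N.
have x_gt0 : (0 < x)%N by rewrite expn_gt0.
have z_gt0 : (0 < z)%N by rewrite expn_gt0.
have ex : (4 ^ (m - k))%N = (4 * x)%N by rewrite -expnS; congr (4 ^ _)%N; lia.
have em1 : (4 ^ m.-1)%N = (z * x)%N by rewrite -expnD; congr (4 ^ _)%N; lia.
have em : (4 ^ m)%N = (4 * (z * x))%N by rewrite -em1 -expnS; congr (4 ^ _)%N; lia.
have emk : (4 ^ (m + k))%N = (4 * (z * x) * z)%N by rewrite expnD em.
have en : (4 ^ n)%N = (4 * (z * x) * (4 * (z * x)))%N by rewrite n2 expnD em.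
(* A is the number of adjacent pairs between the layers k and k+1; up counts
   it from layer k, down from layer k+1 *)
pose A := (\sum_(D in layer C k) \sum_(E in layer C k.+1 | adjacent D E) 1)%N.
have up : (A * (3 * (z * x)) * 2 + #|layer C k| * (4 * (z * x) * z) =
    #|layer C k| * (4 * (z * x) * (4 * (z * x))))%N.
  rewrite -emk -en -!sum_nat_const /A !big_distrl /= -big_split /=.
  apply: eq_bigr => D Dk; have /layerP[oD dD] := Dk.
  have dCD : \dim (C + D) = (m + k)%N.
    by have := dimv_sum_cap C D; rewrite -(lagr_dim oC oD) -/m; lia.
  rewrite -(card_isotropic_out oC (addvSl C D)) dCD -(sum_switch_up oC Dk) -muln2.
  congr (_ * _ + _)%N; rewrite big_distrl /=.
  apply: eq_bigr => E /andP[/layerP[oE dE] /eqP adj].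
  have := card_vsD E D; rewrite capvC -(lagr_dim oC oE) em.
  have -> : \dim (D :&: E) = m.-1 by have := lagr_dim oC oD; rewrite -/m; lia.
  rewrite em1 => e; apply/eqP; rewrite -(eqn_add2r (z * x)) e; lia.
have down : (A * (3 * x) + #|layer C k.+1| * x =
    #|layer C k.+1| * (4 * (z * x)))%N.
  rewrite /A (exchange_big_dep (mem (layer C k.+1))) /=; last by move=> ? ? _ /andP[].
  rewrite -em -!sum_nat_const !big_distrl /= -big_split /=.
  apply: eq_bigr => E Ek; have /layerP[oE dE] := Ek.
  have := card_vsD C E; have -> : \dim (C :&: E) = (m - k.+1)%N by lia.
  rewrite -/m => <-; congr (_ + _)%N; rewrite -(sum_switch_down oC Ek) big_distrl /=.
  rewrite [LHS](eq_bigl (fun D => (D \in layer C k) && adjacent D E)); last first.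
    by move=> D; rewrite Ek.
  apply: eq_bigr => D /andP[/layerP[oD dD] adj].
  have := card_vsD (C :&: D) E.
  have -> : \dim (C :&: D :&: E) = (m - k.+1)%N.
    have := adjacent_dim_cap C adj.
    have : (\dim (C :&: D :&: E) <= \dim (C :&: E))%N by rewrite dimvS // capvS // capvSl.
    by lia.
  have -> : \dim (C :&: D) = (m - k)%N by lia.
  rewrite ex => e; apply/eqP; rewrite -(eqn_add2r x) e; lia.
rewrite -/x em ex.
have -> : (4 * (z * x) %/ 2 = 2 * (z * x))%N by rewrite (_ : 4 = 2 * 2)%N // -mulnA mulKn.
have up1 : (A * 3 + #|layer C k| * (2 * z) = #|layer C k| * (8 * (z * x)))%N.
  apply/eqP; rewrite -(@eqn_pmul2r (2 * (z * x))) ?muln_gt0 ?z_gt0 //; lia.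
have up2 : (A * 3 * x + #|layer C k| * (2 * (z * x)) =
    #|layer C k| * (8 * (z * x) * x))%N.
  by move/(congr1 (muln^~ x)): up1; lia.
rewrite !mulnBr; lia.
Qed.
End Recursion.

(** * Type IV codes *)

Lemma self_dualE D : self_dual D = (orth D == D).
Proof.
have dualE v : (v \in dual D) = (v \in orth D).
  by rewrite inE; apply/forall_inP/orthP => h u /h /eqP.
apply/eqP/eqP => [e|oD].
  by apply/vspaceP => v; rewrite -dualE -e inE.
by apply/setP => v; rewrite dualE oD inE.
Qed.

Lemma type_IVE D : type_IV D = (orth D == D).
Proof.
rewrite /type_IV self_dualE andb_idr // => /eqP oD; apply/forall_inP => v vD.
have /eqP := lagr_isotropic oD vD vD; rewrite herm_self_odd.
by case: odd; rewrite // oner_eq0.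
Qed.

Lemma num_type_IV_neighborsE C k : orth C = C -> (k <= n./2)%N ->
  num_type_IV_neighbors k C = #|layer C k|.
Proof.
move=> oC k_le; apply: eq_card => D; rewrite !inE type_IVE /neighbors k_le /=.
rewrite !self_dualE oC eqxx /=; case: (orth D == D) => //=.
have := dim_orth C; rewrite oC => dC.
by apply/eqP/eqP; lia.
Qed.

End Hermitian.

(* The exponents are truncated natural-number subtractions; they are exact
   because i, j < k <= n./2 and n is even. *)
Theorem theorem5p13 (F : finFieldType) (hF : #|F| = 4%N)
    (n : nat) (n_gt0 : (0 < n)%N) (n_even : n = 0 %[mod 2])
    (C : {vspace 'rV[F]_n}) (hC : type_IV C)
    (k : nat) (k_gt0 : (0 < k)%N) (k_le : (k <= n./2)%N) :
  (num_type_IV_neighbors k C)%:R =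
    (\prod_(0 <= i < k) (2 ^+ (2 * n - 1 - 2 * i) - 2 ^+ (n - 1)))
    / (\prod_(0 <= j < k) (2 ^+ n - 2 ^+ (n - 2 - 2 * j))) :> rat.
Proof.
have oC : orth C = C by apply/eqP; rewrite -type_IVE.
rewrite num_type_IV_neighborsE //.
have n2 : n = (2 * \dim C)%N by have := dim_orth hF C; rewrite oC; lia.
have {k_gt0} : (k <= \dim C)%N by lia.
elim: k {k_le} => [|k IHk] km; first by rewrite card_layer0 // !big_nil divr1.
rewrite !big_nat_recr //= invfM mulrACA -IHk; last exact: ltnW.
have pow4 i : (4 ^ i = 2 ^ (2 * i))%N by rewrite expnM.
(* den and num put the factors of index k in the form of card_layerS *)
have den : 2 ^+ n - 2 ^+ (n - 2 - 2 * k) =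
    (4 ^ \dim C - 4 ^ (\dim C - k.+1))%N%:R :> rat.
  rewrite natrB ?leq_exp2l ?leq_subr // !pow4 !natrX.
  by congr (_ ^+ _ - _ ^+ _); lia.
have num : 2 ^+ (2 * n - 1 - 2 * k) - 2 ^+ (n - 1) =
    (4 ^ \dim C %/ 2 * (4 ^ (\dim C - k) - 1))%N%:R :> rat.
  have -> : (4 ^ \dim C %/ 2 = 2 ^ (n - 1))%N.
    by rewrite pow4 (_ : 2 * \dim C = (n - 1).+1)%N ?expnS ?mulKn //; lia.
  rewrite mulnBr muln1 pow4 -expnD natrB; last by rewrite leq_exp2l //; lia.
  by rewrite !natrX; congr (_ ^+ _ - _); lia.
have den_gt0 : (0 < 4 ^ \dim C - 4 ^ (\dim C - k.+1))%N.
  by rewrite subn_gt0 ltn_exp2l //; lia.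
rewrite num den mulrA -natrM -card_layerS // natrM mulfK //.
by rewrite Num.Theory.pnatr_eq0 -lt0n.
Qed.
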